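(* Let $\mathcal{F}$ be a feasible $f$-triangle of size $d \in \mathbb{N}\cup\{\infty\}$ and $n \in \{0,1,\dots,d\}$. (a) We have $p_{\mathcal{F}}(n,k,j) = p_{\mathcal{F}}(n,n-k,n-j)$ for all $k,j \in \{0,1,\dots,n\}$. (b) The recurrence $$p_{\mathcal{F}}(n,k,j) \ = \ p_{\mathcal{F}}(n,k-1,j) + p_{\mathcal{F}}(n-1,k-1,j-1) - p_{\mathcal{F}}(n-1,k-1,j)$$ holds for all $k,j \in \{0,1,\dots,n\}$ with $k \ge 1$. (c) We have $p_{\mathcal{F}}(n,0,j) = h_{\mathcal{F}}(j,n)$ for every $j \in \{0,1,\dots,n\}$. Equivalently, $\sum_{j=0}^n p_{\mathcal{F}}(n,0,j)x^j = h_{\mathcal{F}}(\sigma_n,x)$. (d) For every $k \in \{0,1,\dots,n\}$, $\sum_{j=0}^n p_{\mathcal{F}}(n,k,j) = h_{\mathcal{F}}(\sigma_n,1)$. Equivalently, the sum on the left-hand side is independent of $k$ and equal to the number of facets of any $\mathcal{F}$-uniform triangulation of the simplex $\sigma_n$. (e) For every $j \in \{0,1,\dots,n\}$, $\sum_{k=0}^n p_{\mathcal{F}}(n,k,j) = (h_{\mathcal{F}})_j(\partial\sigma_{n+1})$, where $(h_{\mathcal{F}})_j(\partial\sigma_{n+1})$ is the coefficient of $x^j$ in $h_{\mathcal{F}}(\partial\sigma_{n+1},x)$.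
   Context: Conventions: $\mathbb{N} = \{0,1,2,\dots\}$; $\{0,1,\dots,d\} := \mathbb{N}$ when $d=\infty$; $n,k,j$ are finite; $\binom{a}{b}:=0$ unless $0\le b\le a$. All simplicial complexes are finite abstract simplicial complexes (containing the empty face, of dimension $-1$). For an $(n-1)$-dimensional simplicial complex $\Delta$, let $f_{i}(\Delta)$ be the number of $i$-dimensional faces, $f(\Delta,x) = \sum_{i=0}^n f_{i-1}(\Delta)x^i$, and $h(\Delta,x) = (1-x)^n f(\Delta, \frac{x}{1-x}) =: \sum_{i=0}^n h_i(\Delta)x^i$. A simplicial complex $\Delta'$ is a triangulation of $\Delta$ if there are geometric realizations $K'$ and $K$ of $\Delta'$ and $\Delta$ such that $K'$ geometrically subdivides $K$. For $F \in \Delta$, the restriction $\Delta'_F$ is the subcomplex of $\Delta'$ corresponding to the triangulation which $K'$ induces on the simplex of $K$ corresponding to $F$. An $f$-triangle of size $d$ is a triangular array $\mathcal{F} = (f_{\mathcal{F}}(i,j))_{0 \le i \le j \le d}$ of nonnegative integers. Given a simplicial complex $\Delta$ of dimension less than $d$, a triangulation $\Delta'$ of $\Delta$ is $\mathcal{F}$-uniform if for all $0 \le i \le j \le d$, the restriction of $\Delta'$ to any $(j-1)$-dimensional face of $\Delta$ has exactly $f_{\mathcal{F}}(i,j)$ faces of dimension $i-1$. Let $\sigma_n$ be the $(n-1)$-dimensional simplex (the complex of all its faces) and $\partial\sigma_n$ its boundary complex. $\mathcal{F}$ is feasible if $\mathcal{F}$-uniform triangulations of $\sigma_n$ exist for all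 finite $n \le d$. Put $f_{\mathcal{F}}(\sigma_n,x) = \sum_{i=0}^n f_{\mathcal{F}}(i,n)x^i$, $h_{\mathcal{F}}(\sigma_n,x) = (1-x)^n f_{\mathcal{F}}(\sigma_n,\frac{x}{1-x}) = \sum_{i=0}^n h_{\mathcal{F}}(i,n)x^i$ (the $h$-polynomial of any $\mathcal{F}$-uniform triangulation of $\sigma_n$), $\ell_{\mathcal{F}}(\sigma_n,x) = \sum_{k=0}^n (-1)^{n-k}\binom{n}{k} h_{\mathcal{F}}(\sigma_k,x)$, and for $0\le k\le n\le d$ $$p_{\mathcal{F},n,k}(x) = \sum_{r=0}^n \ell_{\mathcal{F}}(\sigma_r,x) \sum_{i=0}^r \binom{n-k}{i}\binom{k}{r-i} x^{k-r+i} =: \sum_{j=0}^n p_{\mathcal{F}}(n,k,j)x^j,$$ with $p_{\mathcal{F}}(n,k,j):=0$ for $j\notin\{0,\dots,n\}$. For an $(n-1)$-dimensional simplicial complex $\Delta$, $h_{\mathcal{F}}(\Delta,x) := \sum_{k=0}^n h_k(\Delta)p_{\mathcal{F},n,k}(x)$; this is the $h$-polynomial of any $\mathcal{F}$-uniform triangulation of $\Delta$. Note that $\partial\sigma_{n+1}$ has dimension $n-1$. *)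

(* Defs.v *)
From HB Require Import structures.
From mathcomp Require Import all_boot all_order all_algebra.
From mathcomp Require Import boolp reals.
Set Implicit Arguments.
Unset Strict Implicit.
Unset Printing Implicit Defensive.
Import Order.TTheory GRing.Theory Num.Theory.
Local Open Scope ring_scope.

(** * Abstract simplicial complexes *)

(* Finite simplicial complexes, with the empty face. Points of V need not be
   vertices. Faces are graded by cardinality, i.e. dimension plus one. *)
Record complex (V : finType) := Complex {
  faces :> {set {set V}};
  complex0 : set0 \in faces;
  complexS : forall F G : {set V}, G \subset F -> F \in faces -> G \in faces }.

(* dimension plus one *)
Definition dimS (V : finType) (D : complex V) : nat :=
  (\max_(F in faces D) #|F|)%N.

(* fnum D i is f_{i-1}(D), the number of faces of dimension i - 1. *)
Definition fnum (V : finType) (D : complex V) (i : nat) : nat :=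
  #|[set F in faces D | #|F| == i]|.

Definition facets (V : finType) (D : complex V) : {set {set V}} :=
  [set F : {set V} | maxset (fun G => G \in faces D) F].

Lemma simplex0 n : set0 \in [set: {set 'I_n}].
Proof. by rewrite inE. Qed.

Lemma simplexS n (F G : {set 'I_n}) :
  G \subset F -> F \in [set: {set 'I_n}] -> G \in [set: {set 'I_n}].
Proof. by rewrite !inE. Qed.

(* sigma_n, of dimension n - 1 *)
Definition simplex (n : nat) : complex 'I_n :=
  Complex (@simplex0 n) (@simplexS n).

Lemma boundary0 n : set0 \in [set F : {set 'I_n.+1} | F \proper setT].
Proof. by rewrite inE properT; apply/eqP => /setP /(_ ord0); rewrite !inE. Qed.

Lemma boundaryS n (F G : {set 'I_n.+1}) :
  G \subset F -> F \in [set F : {set 'I_n.+1} | F \proper setT] ->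
  G \in [set F : {set 'I_n.+1} | F \proper setT].
Proof. by rewrite !inE; exact: sub_proper_trans. Qed.

(* The boundary of sigma_{n+1}, of dimension n - 1 *)
Definition boundary_simplexS (n : nat) : complex 'I_n.+1 :=
  Complex (@boundary0 n) (@boundaryS n).

(** * Geometric realizations and triangulations *)

Definition hull (R : realType) (V : finType) (m : nat) (v : V -> 'rV[R]_m)
    (F : {set V}) (x : 'rV[R]_m) : Prop :=
  exists w : V -> R, [/\ forall i, i \in F -> 0 <= w i,
    \sum_(i in F) w i = 1 & x = \sum_(i in F) w i *: v i].

Definition affinely_independent (R : realType) (V : finType) (m : nat)
    (v : V -> 'rV[R]_m) (F : {set V}) : Prop :=
  forall c : V -> R, \sum_(i in F) c i = 0 -> \sum_(i in F) c i *: v i = 0 ->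
  forall i, i \in F -> c i = 0.

(* Placing the vertices of D at the points v realizes D as the geometric
   complex of all [hull v F], F in D. As [hull v set0] is empty, the second
   condition makes v injective on the vertices of D. *)
Definition realization (R : realType) (V : finType) (D : complex V) (m : nat)
    (v : V -> 'rV[R]_m) : Prop :=
  (forall F, F \in faces D -> affinely_independent v F) /\
  (forall F G, F \in faces D -> G \in faces D ->
    forall x, hull v F x -> hull v G x -> hull v (F :&: G) x).

Definition polyhedron (R : realType) (V : finType) (D : complex V) (m : nat)
    (v : V -> 'rV[R]_m) (x : 'rV[R]_m) : Prop :=
  exists2 F, F \in faces D & hull v F x.

(* The realization (D', v') geometrically subdivides (D, v). *)
Definition subdivides (R : realType) (V V' : finType) (D : complex V)
    (D' : complex V') (m : nat) (v : V -> 'rV[R]_m) (v' : V' -> 'rV[R]_m) :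
    Prop :=
  (forall G, G \in faces D' ->
    exists2 F, F \in faces D & forall x, hull v' G x -> hull v F x) /\
  (forall x, polyhedron D v x <-> polyhedron D' v' x).

(* D' as a triangulation of D. The realizations are part of the data because
   the restrictions to the faces of D depend on them. *)
Record triangulation (R : realType) (V V' : finType) (D : complex V)
    (D' : complex V') := Triangulation {
  ambient : nat;
  pt : V -> 'rV[R]_ambient;
  pt' : V' -> 'rV[R]_ambient;
  pt_realization : realization D pt;
  pt'_realization : realization D' pt';
  pt_subdivides : subdivides D D' pt pt' }.

Section Restriction.
Variables (R : realType) (V V' : finType) (D : complex V) (D' : complex V').
Variables (T : triangulation R D D') (F : {set V}).

Definition restr_faces : {set {set V'}} :=
  [set G in faces D' | `[< forall x, hull (pt' T) G x -> hull (pt T) F x >]].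

Lemma restr0 : set0 \in restr_faces.
Proof.
rewrite inE complex0; apply/asboolP => x [w [_]].
by rewrite big_set0 => /esym/eqP; rewrite oner_eq0.
Qed.

Lemma restrS (G H : {set V'}) :
  H \subset G -> G \in restr_faces -> H \in restr_faces.
Proof.
move=> HG; rewrite !inE => /andP[GD /asboolP GF].
rewrite (complexS HG GD); apply/asboolP => x [w [w0 w1 wx]]; apply: GF.
have sumH (U : lmodType R) (g : V' -> U) :
    \sum_(i in G) (if i \in H then g i else 0) = \sum_(i in H) g i.
  rewrite -big_mkcondr; apply: eq_bigl => i.
  by rewrite andb_idl //; exact: (subsetP HG).
exists (fun i => if i \in H then w i else 0); split.
- by move=> i _; case: ifP => // /w0.
- by rewrite (sumH R^o).
- rewrite wx -sumH; apply: eq_bigr => i _.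
  by case: ifP; rewrite ?scale0r.
Qed.

(* The subcomplex of D' triangulating the simplex of D spanned by F *)
Definition restriction : complex V' := Complex restr0 restrS.

End Restriction.

(** * f-triangles *)

(* [f i j] is only meaningful for i <= j <= d, d being the size of f; the other
   values are irrelevant. *)
Definition ftriangle := nat -> nat -> nat.

(* Sizes in N U {oo} are of type [option nat], where [None] is infinity. *)
Definition le_size (n : nat) (d : option nat) : bool :=
  if d is Some e then (n <= e)%N else true.

Definition uniform (d : option nat) (f : ftriangle) (R : realType)
    (V V' : finType) (D : complex V) (D' : complex V')
    (T : triangulation R D D') : Prop :=
  le_size (dimS D) d /\
  forall i j : nat, (i <= j)%N -> le_size j d ->
    forall F, F \in faces D -> #|F| = j -> fnum (restriction T F) i = f i j.

Definition feasible (R : realType) (d : option nat) (f : ftriangle) : Prop :=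
  forall n : nat, le_size n d ->
    exists (V' : finType) (D' : complex V')
      (T : triangulation R (simplex n) D'), uniform d f T.

(** * h-polynomials *)

(* (1 - x)^n p(x / (1 - x)) for p of degree at most n, denominators cleared;
   see [htransE]. *)
Definition htrans (n : nat) (p : {poly int}) : {poly int} :=
  \sum_(i < n.+1) p`_i *: ('X^i * (1 - 'X) ^+ (n - i)).

Lemma htransE (K : fieldType) (n : nat) (p : {poly int}) (x : K) :
  (size p <= n.+1)%N -> x != 1 ->
  (map_poly intr (htrans n p)).[x] =
  (1 - x) ^+ n * (map_poly intr p).[x / (1 - x)].
Proof.
move=> sp x1; have y0 : 1 - x != 0 by rewrite subr_eq0 eq_sym.
have sp' : (size (map_poly intr p : {poly K}) <= n.+1)%N.
  exact: leq_trans (size_poly _ _) sp.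
rewrite (horner_coef_wide _ sp') mulr_sumr rmorph_sum horner_sum.
apply: eq_bigr => i _; rewrite /= map_polyZ rmorphM rmorphXn /= map_polyX.
rewrite rmorphXn rmorphB rmorph1 /= map_polyX !hornerE coef_map /=.
have -> : (1 - x) ^+ n = (1 - x) ^+ (n - i) * (1 - x) ^+ i.
  by rewrite -exprD subnK // -ltnS.
rewrite expr_div_n !mulrA; apply: (canRL (mulfK (expf_neq0 i y0))).
by rewrite -[LHS]mulrA [LHS]mulrC [LHS]mulrA.
Qed.

Definition fpoly (V : finType) (D : complex V) : {poly int} :=
  \poly_(i < (dimS D).+1) (fnum D i)%:Z.

Definition hpoly (V : finType) (D : complex V) : {poly int} :=
  htrans (dimS D) (fpoly D).

(* f_F(sigma_n, x), h_F(sigma_n, x), h_F(j, n) and l_F(sigma_n, x) *)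
Definition fF (f : ftriangle) (n : nat) : {poly int} :=
  \poly_(i < n.+1) (f i n)%:Z.

Definition hF (f : ftriangle) (n : nat) : {poly int} := htrans n (fF f n).

Definition hFnum (f : ftriangle) (j n : nat) : int := (hF f n)`_j.

Definition lF (f : ftriangle) (n : nat) : {poly int} :=
  \sum_(k < n.+1) ((-1) ^+ (n - k) * ('C(n, k))%:Z) *: hF f k.

(* For k <= n. The exponent k - (r - i) is written k + i - r; it is only
   truncated when 'C(k, r - i) = 0. *)
Definition pFpoly (f : ftriangle) (n k : nat) : {poly int} :=
  \sum_(r < n.+1) lF f r *
    \sum_(i < r.+1) ('C(n - k, i) * 'C(k, r - i))%:Z *: 'X^(k + i - r).

Definition pF (f : ftriangle) (n k : nat) (j : int) : int :=
  if (0 <= j) && (j <= n%:Z) then (pFpoly f n k)`_`|j|%N else 0.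

(* h_F(D, x), the h-polynomial of any F-uniform triangulation of D *)
Definition hFpoly (f : ftriangle) (V : finType) (D : complex V) : {poly int} :=
  \sum_(k < (dimS D).+1) (hpoly D)`_k *: pFpoly f (dimS D) k.

(* Main.v *)
Require Import Defs.
From HB Require Import structures.
From mathcomp Require Import all_boot all_order all_algebra.
From mathcomp Require Import boolp reals.
From mathcomp Require Import ring lra zify.
Set Implicit Arguments.
Unset Strict Implicit.
Unset Printing Implicit Defensive.
Import Order.TTheory GRing.Theory Num.Theory.
Local Open Scope ring_scope.

(** Everything except the symmetry (a) and the facet count in (d) is formal.
    Write [h_k] for the polynomial [hF f k] and let [U] be the [{poly int}]-linear
    map from polynomials in [Y] over [{poly int}] to [{poly int}] with
    [U (Y^k) = h_k]. Since [l_r = U ((Y - 1)^r)], the defining double sum of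
    [p_(n,k)] collapses to
      [p_(n,k) = U (Y^(n-k) (Y + x - 1)^k)]    ([pFpoly_umbral]),
    and expanding one factor [Y + x - 1] gives
      [p_(n,k) = p_(n,k-1) + (x - 1) p_(n-1,k-1)]    ([pFpoly_rec]),
    which is (b). The case [k = 0] is (c); setting [x = 1] in the recurrence shows
    that [p_(n,k)(1)] does not depend on [k]; and (e) holds because every
    [h]-number of the boundary of a simplex is [1].

    The recurrence also reduces (a) to [k = 0] ([pF_symmetry]), where it says
    that the reverse of [h_n] is
      [p_(n,n) = sum_k binom(n,k) (x - 1)^(n-k) h_k].
    This is a Dehn-Sommerville relation for a ball: if each face [G] of a uniform
    triangulation of the simplex has weight [x^|G| (1 - x)^(n-|G|)], then [h_n]
    is the total weight of all faces and, by inclusion-exclusion over the faces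
    of the simplex, [p_(n,n)] is the total weight of the interior faces, those
    which lie in no proper face of the simplex.

    The relation comes from half-open decompositions. In barycentric
    coordinates the cones over the faces of the triangulation partition the
    orthant of [R^n] into relatively open simplicial cones. Choose a generic
    vector [y] in the open orthant. Moving slightly in direction [y] from a point
    in the relative interior of the cone over [G], one enters the cone over
    exactly one face [F] with [n] vertices; if [N F] is the set of vertices of
    [F] at which the coordinate of [y] with respect to [F] is negative, then [F]
    is characterized by [N F <= G <= F]. Moving in direction [- y] one stays in
    the orthant precisely when [G] is interior, and then enters exactly one [F],
    characterized by [F - N F <= G <= F] ([half_open_decomposition]). The
    weights of the faces in such an interval add up to [x^|N F|], respectively
    [x^(n - |N F|)], so that the two counts are [sum_F x^|N F|] and
    [sum_F x^(n - |N F|)], which are reverses of each other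
    ([uniform_reciprocity]). The first direction also shows that every face lies in
    one with [n] vertices, so that [F] ranges over the facets and
    [h_n(1)] is their number. *)

(** * Properties of all small positive scalars *)

Section Near0.
Variable R : realFieldType.
Implicit Types P Q : R -> Prop.

Definition near0 P : Prop :=
  exists2 d : R, 0 < d & forall e, 0 < e -> e < d -> P e.

Lemma near0_forall (I : finType) (P : I -> R -> Prop) :
  (forall i, near0 (P i)) -> near0 (fun e => forall i, P i e).
Proof.
move=> nP; have /choice[d dP] : forall i, exists d : R,
    0 < d /\ forall e, 0 < e -> e < d -> P i e.
  by move=> i; have [d d0 dP] := nP i; exists d.
exists (\big[Num.min/1]_i d i).
  by apply/bigmin_gtP; split=> // i _; case: (dP i).
move=> e e0 /bigmin_gtP[_ ed] i.
by apply: (dP i).2 => //; apply: ed.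
Qed.

Lemma near0_and P Q : near0 P -> near0 Q -> near0 (fun e => P e /\ Q e).
Proof.
move=> [d d0 dP] [d' d'0 d'P]; exists (Num.min d d'); first by rewrite lt_min d0.
by move=> e e0; rewrite lt_min => /andP[ed ed']; split; [exact: dP|exact: d'P].
Qed.

Lemma near0_mp P Q : (forall e, 0 < e -> P e -> Q e) -> near0 P -> near0 Q.
Proof. by move=> PQ [d d0 dP]; exists d => // e e0 ed; apply: PQ => //; exact: dP. Qed.

Lemma near0_inhab P : near0 P -> exists2 e, 0 < e & P e.
Proof.
move=> [d d0 dP]; have d2 : 0 < d / 2 by rewrite divr_gt0.
by exists (d / 2) => //; apply: dP => //; rewrite ltr_pdivrMr // ltr_pMr // ltr1n.
Qed.

Lemma near0_affine_gt0 (x z : R) : 0 <= x -> (x = 0 -> 0 < z) ->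
  near0 (fun e => 0 < x + e * z).
Proof.
rewrite le_eqVlt => /predU1P[<- /(_ erefl) z0|x0 _].
  by exists 1 => // e e0 _; rewrite add0r mulr_gt0.
have d0 : 0 < 1 + `|z| by rewrite ltr_pwDl.
exists (x / (1 + `|z|)); first by rewrite divr_gt0.
move=> e e0; rewrite ltr_pdivlMr // => ex.
have : - (e * z) <= e * `|z| by rewrite -mulrN ler_pM2l // lerNl; exact: lerNnormlW.
by move: ex; rewrite mulrDr mulr1; lra.
Qed.

(** If [x] were negative, [x + e * z] would be negative for all small [e]. The
    hypothesis asks for positivity at arbitrarily small [e] only, which is what
    pigeonholing over finitely many cones provides. *)
Lemma frequently_affine_ge0 (x z : R) :
  (forall d, 0 < d -> exists2 e, 0 < e < d & 0 < x + e * z) ->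
  0 <= x /\ (x = 0 -> 0 < z).
Proof.
move=> fr; split.
  rewrite leNgt; apply/negP => x0.
  have [||d d0 dP] := @near0_affine_gt0 (- x) (- z).
  - by rewrite oppr_ge0 ltW.
  - by move=> /eqP; rewrite oppr_eq0 lt_eqF.
  have [e /andP[e0 ed] ez] := fr d d0.
  by have := dP e e0 ed; rewrite mulrN; lra.
move=> x0; have [e /andP[e0 _]] := fr 1 ltr01.
by rewrite x0 add0r pmulr_rgt0.
Qed.

Lemma not_near0 P : ~ near0 P ->
  forall d, 0 < d -> exists2 e, 0 < e < d & ~ P e.
Proof.
move=> nP d d0; apply: contrapT => ex; apply: nP; exists d => // e e0 ed.
by apply: contrapT => nPe; apply: ex; exists e; rewrite ?e0.
Qed.

End Near0.

(** * Linear combinations and generic vectors *)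

Section Families.
Variables (R : realFieldType) (m : nat) (V : finType) (b : V -> 'rV[R]_m).
Implicit Types (F G H : {set V}) (c : V -> R) (x y z : 'rV[R]_m).

Definition lincomb F c : 'rV[R]_m := \sum_(v in F) c v *: b v.

Definition independent F : Prop :=
  forall c, lincomb F c = 0 -> forall v, v \in F -> c v = 0.

(** All index sets of size less than [m] are considered, dependent or not, so
    that genericity refers to no complex. *)
Definition generic z : Prop :=
  forall H c, (#|H| < m)%N -> z <> lincomb H c.

Definition rows F : 'M[R]_(#|F|, m) := \matrix_i b (enum_val i).

Lemma lincombE F c : lincomb F c = (\row_i c (enum_val i)) *m rows F.
Proof.
rewrite mulmx_sum_row /lincomb big_enum_val; apply: eq_bigr => i _.
by rewrite mxE rowK.
Qed.

Lemma lincombD F c c' : lincomb F (fun v => c v + c' v) = lincomb F c + lincomb F c'.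
Proof. by rewrite -big_split; apply: eq_bigr => v _; rewrite scalerDl. Qed.

Lemma lincombZ F a c : lincomb F (fun v => a * c v) = a *: lincomb F c.
Proof. by rewrite scaler_sumr; apply: eq_bigr => v _; rewrite scalerA. Qed.

Lemma lincomb_sub F G c : G \subset F ->
  (forall v, v \in F -> v \notin G -> c v = 0) -> lincomb F c = lincomb G c.
Proof.
move=> GF c0; rewrite /lincomb (big_setID G) /= (setIidPr GF).
rewrite [X in _ + X]big1 ?addr0 // => v; rewrite inE => /andP[vG vF].
by rewrite c0 ?scale0r.
Qed.

Lemma independent_inj F c c' : independent F -> lincomb F c = lincomb F c' ->
  forall v, v \in F -> c v = c' v.
Proof.
move=> iF e v vF; apply/eqP; rewrite -subr_eq0; apply/eqP.
apply: (iF (fun v => c v - c' v)) => //.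
rewrite (lincombD F c (fun v => - c' v)) e -[X in X + _]scale1r.
have -> : lincomb F (fun v => - c' v) = - lincomb F c'.
  by rewrite -sumrN; apply: eq_bigr => u _; rewrite scaleNr.
by rewrite scale1r subrr.
Qed.

(** Translates between the coefficient functions of [lincomb], which ignore
    values outside [F], and row vectors indexed by the enumeration of [F]. *)
Lemma row_fun F (u : 'rV[R]_#|F|) : exists c, u = \row_i c (enum_val i).
Proof.
exists (fun v => \sum_i u 0 i *+ (enum_val i == v)); apply/rowP => i; rewrite mxE.
rewrite (bigD1 i) //= eqxx big1 ?addr0 // => j ji.
by rewrite (inj_eq enum_val_inj) (negPf ji).
Qed.

Lemma independent_row_free F : independent F -> row_free (rows F).
Proof.
move=> iF; rewrite -kermx_eq0; apply/rowV0P => u /sub_kermxP.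
have [c ->] := row_fun u; rewrite -lincombE => /iF c0.
by apply/rowP => i; rewrite !mxE c0 // enum_valP.
Qed.

(** The vectors lie in the coordinate subspace spanned by [S], of dimension
    [#|S|]: their matrix factors through it. *)
Lemma independent_card F (S : {set 'I_m}) : independent F ->
  (forall v i, v \in F -> i \notin S -> b v 0 i = 0) -> (#|F| <= #|S|)%N.
Proof.
move=> /independent_row_free/eqP <- bS.
pose A : 'M[R]_(#|F|, #|S|) := \matrix_(i, j) b (enum_val i) 0 (enum_val j).
pose B : 'M[R]_(#|S|, m) := \matrix_i delta_mx 0 (enum_val i).
suff -> : rows F = A *m B by exact: mulmx_max_rank.
apply/row_matrixP => i; rewrite rowK row_mul mulmx_sum_row [LHS]row_sum_delta.
rewrite (bigID (mem S)) /= [X in _ + X]big1 ?addr0 => [|j jS].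
  by rewrite big_enum_val; apply: eq_bigr => j _; rewrite rowK !mxE.
by rewrite bS ?scale0r // enum_valP.
Qed.

Lemma independent_span F x : independent F -> #|F| = m -> exists c, x = lincomb F c.
Proof.
move=> /independent_row_free iF Fm.
have /submxP[u ->] : (x <= rows F)%MS.
  by apply: submx_full; rewrite /row_full (eqP iF) Fm.
by have [c ->] := row_fun u; exists c; rewrite lincombE.
Qed.

Lemma proper_span_equation H : (#|H| < m)%N ->
  exists2 a : 'cV[R]_m, a != 0 & forall c, lincomb H c *m a = 0.
Proof.
move=> Hm; have /rowV0Pn[u uk u0] : kermx (rows H)^T != 0.
  rewrite -mxrank_eq0 mxrank_ker mxrank_tr -lt0n subn_gt0.
  exact: leq_ltn_trans (rank_leq_row _) Hm.
exists u^T => [|c]; first by apply: contra u0 => /eqP u0; rewrite -[u]trmxK u0 trmx0.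
rewrite lincombE -mulmxA -[X in _ *m X]trmxK trmx_mul trmxK (sub_kermxP uk).
by rewrite trmx0 mulmx0.
Qed.

(** A point [(1, t, ..., t^(m-1))] of the moment curve lies on a hyperplane only
    if [t] is a root of the polynomial of degree less than [m] given by the
    equation of the hyperplane. Finitely many such polynomials are to be avoided,
    so some positive integer [t] works. *)
Lemma exists_generic : exists2 y : 'rV[R]_m, (forall i, 0 < y 0 i) & generic y.
Proof.
pose mom (t : R) : 'rV[R]_m := \row_i t ^+ i.
have /choice[q qP] : forall H, exists q : {poly R}, q != 0 /\
    ((#|H| < m)%N -> forall t c, mom t = lincomb H c -> root q t).
  move=> H; have [Hm|mH] := ltnP #|H| m; last by exists 1; rewrite oner_eq0.
  (* The coefficients of the equation of a hyperplane containing the span. *)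
  have [a a0 aH] := proper_span_equation Hm.
  exists (rVpoly a^T); split=> [|_ t c tc].
    by apply: contra a0 => /eqP q0; rewrite -[a]trmxK -[a^T]rVpolyK q0 linear0 trmx0.
  rewrite rootE; apply/eqP; have := aH c; rewrite -tc => /matrixP/(_ 0 0).
  rewrite !mxE => <-; rewrite /rVpoly horner_poly; apply: eq_bigr => i _.
  by rewrite valK !mxE mulrC.
pose Q := \prod_H q H; have Q0 : Q != 0 by apply/prodf_neq0 => H _; case: (qP H).
pose ts : seq R := [seq i.+1%:R | i <- iota 0 (size Q)].
have /allPn[t tts tQ] : ~~ all (root Q) ts.
  apply/negP => /(max_poly_roots Q0); rewrite size_map size_iota ltnn => ts_uniq.
  suff /ts_uniq : uniq ts by [].
  by rewrite map_inj_uniq ?iota_uniq // => j k /eqP; rewrite eqr_nat eqSS => /eqP.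
have t0 : 0 < t by case/mapP: tts => i _ ->; rewrite ltr0n.
exists (mom t) => [j|H c Hm tc]; first by rewrite mxE exprn_gt0.
case/negP: tQ; rewrite /Q (bigD1 H) //= rootM.
by rewrite ((qP H).2 Hm t c tc).
Qed.

(** A zero coordinate would put the vector in the span of fewer than [m]
    vectors. *)
Lemma generic_coord F c : #|F| = m -> generic (lincomb F c) ->
  forall v, v \in F -> c v != 0.
Proof.
move=> Fm g v vF; apply/eqP => cv; apply: (g (F :\ v) c).
  by rewrite -Fm (cardsD1 v F) vF.
by apply: lincomb_sub; rewrite ?subD1set // => w wF; rewrite !inE wF andbT negbK => /eqP ->.
Qed.

Lemma genericN z : generic z -> generic (- z).
Proof.
move=> g H c Hm e; apply: (g H (fun v => -1 * c v) Hm).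
by rewrite lincombZ -e scaleN1r opprK.
Qed.

End Families.

(** * Simplicial fans subdividing the orthant *)

Section Fans.
Variables (R : realFieldType) (m : nat) (V : finType) (D : complex V).
Variable b : V -> 'rV[R]_m.
Implicit Types (F G H : {set V}) (c : V -> R) (x y z : 'rV[R]_m).

Definition open_cone G x : Prop :=
  exists2 c, (forall v, v \in G -> 0 < c v) & x = lincomb b G c.

(** The relatively open cones over the faces of [D] partition the orthant, the
    origin being the cone over the empty face. Working with cones instead of
    simplices lets the empty face take part in every argument below. *)
Record orthant_fan : Prop := OrthantFan {
  fan_independent : forall G, G \in D -> independent b G;
  fan_ge0 : forall G v i, G \in D -> v \in G -> 0 <= b v 0 i;
  fan_cover : forall x, (forall i, 0 <= x 0 i) -> exists2 G, G \in D & open_cone G x;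
  fan_unique : forall G H x, G \in D -> H \in D ->
    open_cone G x -> open_cone H x -> G = H }.

Hypothesis fanD : orthant_fan.

Definition center G : 'rV[R]_m := lincomb b G (fun=> 1).

(** [F] is full-dimensional, has [G] as a face, and a small step in direction
    [z] from the center of [G] ends in the open cone over [F]: the coordinates
    of [z] need to be positive only where those of the center vanish. *)
Definition enters G z F : Prop :=
  [/\ F \in D, #|F| = m, G \subset F
    & exists2 c, z = lincomb b F c & forall v, v \in F -> v \notin G -> 0 < c v].

Lemma fan_card G : G \in D -> (#|G| <= m)%N.
Proof.
move=> /(fan_independent fanD)/(independent_card (S := setT)).
by rewrite cardsT card_ord; apply=> v i _; rewrite inE.
Qed.

Lemma open_cone_ge0 F x i : F \in D -> open_cone F x -> 0 <= x 0 i.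
Proof.
move=> FD [c c0 ->]; rewrite summxE; apply: sumr_ge0 => v vF; rewrite mxE.
by rewrite mulr_ge0 ?(fan_ge0 fanD i FD) // ltW // c0.
Qed.

Lemma center_wide G F : G \subset F ->
  center G = lincomb b F (fun v => (v \in G)%:R).
Proof.
move=> GF; rewrite (@lincomb_sub _ _ _ _ _ G) //.
  by apply: eq_bigr => v ->.
by move=> v _ /negPf->.
Qed.

Lemma enters_open_cone G z F : enters G z F ->
  near0 (fun e => open_cone F (center G + e *: z)).
Proof.
move=> [FD _ GF [c -> c0]].
suff: near0 (fun e => forall v, v \in F -> 0 < (v \in G)%:R + e * c v).
  apply: near0_mp => e _ ce; exists (fun v => (v \in G)%:R + e * c v) => //.
  by rewrite lincombD lincombZ -center_wide.
apply: near0_forall => v; have [vF|vF] := boolP (v \in F); last by exists 1.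
have [d d0 dP] : near0 (fun e => 0 < (v \in G)%:R + e * c v).
  apply: near0_affine_gt0; first exact: ler0n.
  by case: (boolP (v \in G)) => [_ /eqP|vG _]; [rewrite oner_eq0|exact: c0].
by exists d => // e e0 ed _; exact: dP.
Qed.

(** Both open cones contain the end point of a small enough common step. *)
Lemma enters_unique G z F F' : enters G z F -> enters G z F' -> F = F'.
Proof.
move=> zF zF'.
have [e _ [eF eF']] := near0_inhab (near0_and (enters_open_cone zF) (enters_open_cone zF')).
by case: zF zF' => FD _ _ _ [FD' _ _ _]; exact: (fan_unique fanD FD FD' eF eF').
Qed.

Lemma enters_ge0 G z F : enters G z F ->
  near0 (fun e => forall i, 0 <= (center G + e *: z) 0 i).
Proof.
move=> zF; apply: near0_mp (enters_open_cone zF) => e _ eF i.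
by apply: open_cone_ge0 eF; case: zF.
Qed.

(** Small steps end in the orthant, so some fixed cone [F] contains the end
    points of arbitrarily small ones. Two of these points show that [z], hence
    also the center of [G], is in the span of [F]; genericity makes [F]
    full-dimensional. The coordinates of the center in [F] are limits of positive
    numbers, hence nonnegative, and by uniqueness of open cones they are
    positive exactly on [G]. *)
Lemma enters_exists G z : G \in D -> generic b z ->
  near0 (fun e => forall i, 0 <= (center G + e *: z) 0 i) ->
  exists F, enters G z F.
Proof.
move=> GD gz [d1 d10 xz].
have [F [FD Ffr]] : exists F, F \in D /\ forall d, 0 < d ->
    exists2 e, 0 < e < d & open_cone F (center G + e *: z).
  apply: contrapT => nF.
  have [d d0 dP] : near0 (fun e => forall F, F \in D -> ~ open_cone F (center G + e *: z)).
    apply: near0_forall => F; apply: contrapT => /not_near0 frF; apply: nF.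
    exists F; split.
      by have [e _ ] := frF 1 ltr01; case: (F \in D) => // nFe; case: nFe.
    move=> d d0; have [e ed nFe] := frF d d0; exists e => //.
    by apply: contrapT => nFe'; apply: nFe.
  have md : 0 < Num.min d d1 by rewrite lt_min d0.
  have [e e0 [ed ed1]] : exists2 e, 0 < e & e < d /\ e < d1.
    exists (Num.min d d1 / 2); rewrite ?divr_gt0 //.
    apply/andP; rewrite -lt_min ltr_pdivrMr // ltr_pMr // ltr1n //.
  have [H HD He] := fan_cover fanD (xz e e0 ed1).
  exact: (dP e e0 ed H HD He).
have iF := fan_independent fanD FD.
(* Two distinct end points in the cone over [F] determine [z]. *)
have [e1 /andP[e10 _] [c1 _ xc1]] := Ffr 1 ltr01.
have [e2 /andP[e20 e21] [c2 _ xc2]] := Ffr e1 e10.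
have e12 : e1 - e2 != 0 by rewrite subr_eq0 gt_eqF.
pose c v := (e1 - e2)^-1 * (c1 v + -1 * c2 v).
have zc : z = lincomb b F c.
  rewrite lincombZ lincombD lincombZ -xc1 -xc2 scaleN1r opprD addrACA subrr add0r.
  by rewrite -scalerBl scalerA mulVf // scale1r.
have Fm : #|F| = m.
  apply/eqP; rewrite eqn_leq fan_card //= leqNgt; apply/negP => Fm.
  exact: (gz F c Fm zc).
pose a v := c1 v + - e1 * c v.
have xa : center G = lincomb b F a.
  by rewrite lincombD lincombZ -xc1 -zc scaleNr addrK.
have ac v : v \in F -> 0 <= a v /\ (a v = 0 -> 0 < c v).
  move=> vF; apply: frequently_affine_ge0 => d d0.
  have [e ed [c' c'0 xc']] := Ffr d d0; exists e => //.
  rewrite -(@independent_inj _ _ _ _ _ c' (fun v => a v + e * c v) iF) ?c'0 //.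
  by rewrite -xc' lincombD lincombZ -zc -xa.
have GE : G = [set v in F | 0 < a v].
  apply: (@fan_unique fanD _ _ (center G)) => //.
  - by apply: complexS FD; apply/subsetP => v; rewrite inE => /andP[].
  - by exists (fun=> 1).
  - exists a => [v|]; first by rewrite inE => /andP[].
    rewrite xa; apply: lincomb_sub => [|v vF].
      by apply/subsetP => v; rewrite inE => /andP[].
    rewrite inE vF /= -leNgt => av; apply/eqP.
    by rewrite eq_le av (ac v vF).1.
exists F; split=> //; first by rewrite GE; apply/subsetP => v; rewrite inE => /andP[].
exists c => // v vF; rewrite GE inE vF /= -leNgt => av.
by apply: (ac v vF).2; apply/eqP; rewrite eq_le av (ac v vF).1.
Qed.

Definition chambers : {set {set V}} := [set F in faces D | #|F| == m].

(** [N F] is the set of vertices at which a fixed generic positive vector [y]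
    has a negative coordinate in [F]; the two counts come from the directions
    [y] and [- y]. A small step in direction [y] always stays in the orthant; one
    in direction [- y] does so iff no coordinate of the center of [G] vanishes,
    that is, iff [G] is an interior face. *)
Lemma half_open_decomposition : exists N : {set V} -> {set V},
  [/\ forall F, F \in chambers -> N F \subset F,
      forall G, G \in D ->
        #|[set F in chambers | (N F \subset G) && (G \subset F)]| = 1%N
    & forall G, G \in D ->
        #|[set F in chambers | (F :\: N F \subset G) && (G \subset F)]|
          = [forall i, 0 < center G 0 i] :> nat].
Proof.
have [y y0 gy] := exists_generic b.
have /choice[c yc] : forall F, exists c, F \in chambers -> y = lincomb b F c.
  move=> F; have [|nF] := boolP (F \in chambers); last by exists (fun=> 0).
  rewrite inE => /andP[FD /eqP Fm].
  by have [c ->] := independent_span y (fan_independent fanD FD) Fm; exists c.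
have c0 F v : F \in chambers -> v \in F -> c F v != 0.
  move=> Fc; apply: (@generic_coord _ _ _ b F (c F)); last by rewrite -yc.
  by move: Fc; rewrite inE => /andP[_ /eqP].
have card_enters z (P : pred {set V}) G : G \in D -> generic b z ->
    (forall F, enters G z F <-> F \in chambers /\ P F) ->
    #|[set F in chambers | P F]| =
      `[< near0 (fun e => forall i, 0 <= (center G + e *: z) 0 i) >] :> nat.
  move=> GD gz PE; case: asboolP => [/(enters_exists GD gz)[F zF]|nz].
    apply/eqP/cards1P; exists F; apply/setP => F'; rewrite in_set1 in_set.
    apply/andP/eqP => [/PE/enters_unique|->]; last exact/PE.
    exact.
  apply/eqP; rewrite cards_eq0; apply/eqP/setP => F; rewrite [RHS]inE inE.
  by apply/negP => /andP/PE/enters_ge0.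
exists (fun F => [set v in F | c F v < 0]); split.
- by move=> F _; apply/subsetP => v; rewrite inE => /andP[].
- move=> G GD; rewrite (card_enters y
    (fun F => ([set v in F | c F v < 0] \subset G) && (G \subset F)) G) //.
    case: asboolP => // -[]; exists 1 => // e e0 _ i; rewrite !mxE.
    apply: addr_ge0; last by rewrite mulr_ge0 // ltW.
    rewrite summxE; apply: sumr_ge0 => v vG.
    by rewrite mxE mul1r (fan_ge0 fanD i GD).
  move=> F; split=> [[FD Fm GF [c' yc' c'0]]|[Fc /andP[NG GF]]].
    have Fc : F \in chambers by rewrite inE FD Fm eqxx.
    split=> //; rewrite GF andbT; apply/subsetP => v; rewrite inE => /andP[vF cv].
    have iF := fan_independent fanD FD.
    apply: contraTT cv => /(c'0 v vF).
    rewrite -leNgt (@independent_inj _ _ _ _ _ (c F) c' iF) // -?yc // => /ltW //.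
  move: (Fc); rewrite inE => /andP[FD /eqP Fm]; split=> //.
  exists (c F); first exact: yc.
  move=> v vF; apply: contraR; rewrite -leNgt => cv.
  by apply: (subsetP NG); rewrite inE vF lt_neqAle c0.
- move=> G GD; have gNy := genericN gy.
  rewrite (card_enters (- y)
    (fun F => (F :\: [set v in F | c F v < 0] \subset G) && (G \subset F)) G) //; last first.
    move=> F; have NE : F \in chambers -> F :\: [set v in F | c F v < 0] =
        [set v in F | 0 < c F v].
      move=> Fc; apply/setP => v; rewrite !inE; case: (boolP (v \in F)) => //= vF.
      by rewrite andbT -leNgt le_eqVlt eq_sym (negPf (c0 F v Fc vF)).
    have mE : F \in chambers -> - y = lincomb b F (fun v => -1 * c F v).
      by move=> Fc; rewrite lincombZ -yc // scaleN1r.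
    split=> [[FD Fm GF [c' yc' c'0]]|[Fc /andP[NG GF]]].
      have Fc : F \in chambers by rewrite inE FD Fm eqxx.
      split=> //; rewrite GF andbT NE //; apply/subsetP => v; rewrite inE => /andP[vF cv].
      have iF := fan_independent fanD FD.
      apply: contraTT cv => /(c'0 v vF).
      rewrite -(@independent_inj _ _ _ _ _ (fun v => -1 * c F v) c' iF) // -?mE //.
      by rewrite mulN1r oppr_gt0 -leNgt => /ltW.
    move: (Fc); rewrite inE => /andP[FD /eqP Fm]; split=> //.
    exists (fun v => -1 * c F v); first exact: mE.
    move=> v vF; rewrite mulN1r oppr_gt0; apply: contraR; rewrite -leNgt => cv.
    by apply: (subsetP NG); rewrite NE // inE vF lt_neqAle eq_sym c0.
  congr nat_of_bool; apply/asboolP/forallP => [[d d0 dP] i|xG].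
    have [e e0 /(_ i)] : exists2 e, 0 < e & forall i, 0 <= (center G + e *: - y) 0 i.
      exact: near0_inhab (ex_intro2 _ _ d d0 dP).
    rewrite !mxE mulrN subr_ge0; apply: lt_le_trans.
    by rewrite mulr_gt0.
  apply: near0_forall => i.
  have : near0 (fun e => 0 < center G 0 i + e * - y 0 i).
    by apply: near0_affine_gt0; [exact: ltW|move=> x0; move: (xG i); rewrite x0 ltxx].
  by apply: near0_mp => e _; rewrite !mxE => /ltW.
Qed.

End Fans.

(** * From triangulations of a simplex to fans *)

Section Barycentric.
Variables (R : realType) (n : nat) (V' : finType) (D' : complex V').
Variable T : triangulation R (simplex n) D'.
Local Notation P := (pt T).
Local Notation P' := (pt' T).
Implicit Types (x : 'rV[R]_n) (S : {set 'I_n}) (G H : {set V'}).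

Definition bary_point x := \sum_i x 0 i *: P i.
Definition mass x := \sum_i x 0 i.

(** Barycentric coordinates are unique. Prescribing [mass] turns affine
    statements about points into linear statements about coordinate rows. *)
Lemma bary_inj x x' : bary_point x = bary_point x' -> mass x = mass x' -> x = x'.
Proof.
move=> ep em; have aT : affinely_independent P setT.
  by apply: (pt_realization T).1; rewrite inE.
have sT (U : nmodType) (g : 'I_n -> U) : \sum_(i in setT) g i = \sum_i g i.
  by apply: eq_bigl => i; rewrite inE.
apply/rowP => i; apply/eqP; rewrite -subr_eq0; apply/eqP.
apply: (aT (fun i => x 0 i - x' 0 i)) => //.
  by rewrite sT sumrB; move: em; rewrite /mass => ->; rewrite subrr.
rewrite sT; under eq_bigr do rewrite scalerBl.
by rewrite sumrB; move: ep; rewrite /bary_point => ->; rewrite subrr.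
Qed.

Lemma hull_simplexP S x : mass x = 1 ->
  hull P S (bary_point x) <-> (forall i, 0 <= x 0 i) /\ (forall i, i \notin S -> x 0 i = 0).
Proof.
move=> x1; split=> [[w [w0 w1 xw]]|[x0 xS]].
  have -> : x = \row_i (if i \in S then w i else 0).
    apply: bary_inj.
      rewrite xw big_mkcond; apply: eq_bigr => i _; rewrite mxE.
      by case: ifP; rewrite ?scale0r.
    rewrite x1 -w1 big_mkcond; apply: eq_bigr => i _; by rewrite mxE.
  split=> i; rewrite mxE; last by move/negPf->.
  by case: ifP => // /w0.
exists (fun i => x 0 i); split=> //.
  rewrite -x1 /mass [RHS](bigID (mem S)) /= [X in _ + X]big1 ?addr0 // => i.
rewrite /bary_point (bigID (mem S)) /= [X in _ + X]big1 ?addr0 // => i iS.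
by rewrite xS ?scale0r.
Qed.

Lemma hull_vertex (W : finType) (q : W -> 'rV[R]_(ambient T)) (F : {set W}) v :
  v \in F -> hull q F (q v).
Proof.
move=> vF; exists (fun u => (u == v)%:R); split.
- by move=> i _; exact: ler0n.
- by rewrite (bigD1 v) //= eqxx big1 ?addr0 // => i /andP[_ /negPf->].
- rewrite (bigD1 v) //= eqxx scale1r big1 ?addr0 // => i /andP[_ /negPf->].
  by rewrite scale0r.
Qed.

Lemma exists_bary_coords : exists b : V' -> 'rV[R]_n, forall G v, G \in D' -> v \in G ->
  [/\ forall i, 0 <= b v 0 i, mass (b v) = 1 & bary_point (b v) = P' v].
Proof.
have /choice[b bP] : forall v, exists x, [set v] \in D' ->
    [/\ forall i, 0 <= x 0 i, mass x = 1 & bary_point x = P' v].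
  move=> v; have [vD|] := boolP ([set v] \in D'); last by exists 0.
  have [F _ /(_ _ (hull_vertex _ (set11 v)))[w [w0 w1 ->]]] := (pt_subdivides T).1 _ vD.
  exists (\row_i (if i \in F then w i else 0)) => _; split=> [i||].
  - by rewrite mxE; case: ifP => // /w0.
  - by rewrite -w1 [RHS]big_mkcond; apply: eq_bigr => i _; rewrite mxE.
  - rewrite [RHS]big_mkcond; apply: eq_bigr => i _; rewrite mxE.
    by case: ifP; rewrite ?scale0r.
by exists b => G v GD vG; apply/bP/(complexS _ GD); rewrite sub1set.
Qed.

Section Coordinates.
Variable b : V' -> 'rV[R]_n.
Hypothesis bP : forall G v, G \in D' -> v \in G ->
  [/\ forall i, 0 <= b v 0 i, mass (b v) = 1 & bary_point (b v) = P' v].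

Lemma bary_point_lincomb G w : G \in D' ->
  bary_point (lincomb b G w) = \sum_(v in G) w v *: P' v.
Proof.
move=> GD; rewrite /bary_point; under eq_bigr => i _ do rewrite summxE scaler_suml.
rewrite exchange_big; apply: eq_bigr => v vG /=; case: (bP GD vG) => _ _ <-.
by rewrite scaler_sumr; apply: eq_bigr => i _; rewrite mxE scalerA.
Qed.

Lemma mass_lincomb G w : G \in D' -> mass (lincomb b G w) = \sum_(v in G) w v.
Proof.
move=> GD; rewrite /mass; under eq_bigr => i _ do rewrite summxE.
rewrite exchange_big; apply: eq_bigr => v vG /=; case: (bP GD vG) => _ b1 _.
by under eq_bigr do rewrite mxE; rewrite -mulr_sumr -/(mass (b v)) b1 mulr1.
Qed.

Lemma bary_independent G : G \in D' -> independent b G.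
Proof.
move=> GD c c0; apply: ((pt'_realization T).1 G GD).
  by rewrite -(mass_lincomb _ GD) c0 /mass big1 // => i _; rewrite mxE.
rewrite -(bary_point_lincomb _ GD) c0 /bary_point big1 // => i _.
by rewrite mxE scale0r.
Qed.

(** Scaled to [mass] one, [x] is a common point of the simplices of [G] and [H],
    hence in the simplex of their intersection. Its coordinates with respect to
    [G] are unique, so they vanish outside [H]; but they are all positive. *)
Lemma bary_open_cone_sub G H x : G \in D' -> H \in D' ->
  open_cone b G x -> open_cone b H x -> G \subset H.
Proof.
move=> GD HD [c c0 xc] [c' c'0 xc']; apply/subsetP => v vG.
have s0 : 0 < mass x.
  rewrite xc mass_lincomb // (bigD1 v) //= ltr_pwDl ?c0 // sumr_ge0 // => u.
  by move=> /andP[uG _]; rewrite ltW // c0.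
have hu F a : F \in D' -> (forall u, u \in F -> 0 < a u) -> x = lincomb b F a ->
    hull P' F ((mass x)^-1 *: bary_point x).
  move=> FD a0 xa; exists (fun u => (mass x)^-1 * a u); split.
  - by move=> u uF; rewrite mulr_ge0 ?invr_ge0 ?(ltW s0) // ltW // a0.
  - by rewrite -mulr_sumr -(mass_lincomb a FD) -xa mulVf // gt_eqF.
  - rewrite {2}xa (bary_point_lincomb _ FD) scaler_sumr.
    by apply: eq_bigr => u _; rewrite scalerA.
have [w [_ w1 xw]] := (pt'_realization T).2 G H GD HD _ (hu G c GD c0 xc) (hu H c' HD c'0 xc').
apply: contraT => vH; have: c v = mass x * (if v \in G :&: H then w v else 0).
  apply: (independent_inj (bary_independent GD)
    (c' := fun v => mass x * (if v \in G :&: H then w v else 0))) => //.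
  have GHD : G :&: H \in D' by apply: complexS GD; exact: subsetIl.
  have -> : lincomb b G (fun v => mass x * (if v \in G :&: H then w v else 0))
      = mass x *: lincomb b (G :&: H) w.
    rewrite lincombZ (@lincomb_sub _ _ _ _ _ (G :&: H)) ?subsetIl // => [|u _ /negPf-> //].
    by congr (_ *: _); apply: eq_bigr => u ->.
  rewrite -xc; apply: bary_inj.
    apply: (scalerI (invr_neq0 (lt0r_neq0 s0))); rewrite xw -bary_point_lincomb //.
    rewrite /bary_point scaler_sumr; apply: eq_bigr => i _.
    by rewrite mxE scalerA mulKf // gt_eqF.
  rewrite [RHS]/mass; under eq_bigr do rewrite mxE.
  by rewrite -mulr_sumr -/(mass (lincomb _ _ _)) mass_lincomb // w1 mulr1.
by rewrite inE (negPf vH) andbF mulr0 => cv; move: (c0 v vG); rewrite cv ltxx.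
Qed.

(** Covering: a nonzero point of the orthant, scaled to [mass] one, is in the
    simplex, hence in some simplex of the triangulation; the open cone containing
    it is spanned by the vertices of nonzero weight. *)
Lemma bary_fan : orthant_fan D' b.
Proof.
split; first exact: bary_independent.
- by move=> G v i GD vG; case: (bP GD vG).
- move=> x x0; have [mx0|mx0] := eqVneq (mass x) 0.
    exists set0; rewrite ?complex0 //; exists (fun=> 0) => [v|]; rewrite ?inE //.
    rewrite /lincomb big_set0; apply/rowP => i; rewrite mxE.
    by apply: (psumr_eq0P _ mx0) => // j _; exact: x0.
  have m0 : 0 < mass x by rewrite lt_neqAle eq_sym mx0 sumr_ge0.
  pose x1 := (mass x)^-1 *: x.
  have mx1 : mass x1 = 1.
    by rewrite /mass; under eq_bigr do rewrite mxE; rewrite -mulr_sumr mulVf.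
  have [G GD [w [w0 w1 xw]]] : polyhedron D' P' (bary_point x1).
    apply/(pt_subdivides T).2; exists setT; first by rewrite inE.
    apply/hull_simplexP => //; split=> i; last by rewrite inE.
    by rewrite mxE mulr_ge0 // invr_ge0 ltW.
  have x1w : x1 = lincomb b G w.
    by apply: bary_inj; rewrite ?bary_point_lincomb // mass_lincomb // mx1 w1.
  exists [set v in G | 0 < w v].
    by apply: complexS GD; apply/subsetP => v; rewrite inE => /andP[].
  exists (fun v => mass x * w v) => [v|].
    by rewrite inE => /andP[_ ?]; rewrite mulr_gt0.
  rewrite lincombZ -(@lincomb_sub _ _ _ _ G).
  - by rewrite -x1w scalerA mulfV // scale1r.
  - by apply/subsetP => v; rewrite inE => /andP[].
  - move=> v vG; rewrite inE vG /= -leNgt => wv.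
    by apply/eqP; rewrite eq_le wv w0.
- move=> G H x GD HD Gx Hx; apply/eqP.
  by rewrite eqEsubset (bary_open_cone_sub GD HD Gx Hx) (bary_open_cone_sub HD GD Hx Gx).
Qed.

Definition carrier G : {set 'I_n} := [set i | 0 < center b G 0 i].

Lemma carrierP G v i : G \in D' -> v \in G -> i \notin carrier G -> b v 0 i = 0.
Proof.
move=> GD vG; rewrite inE -leNgt summxE => ci.
have b0 u : u \in G -> 0 <= b u 0 i by move=> uG; case: (bP GD uG).
apply/eqP; rewrite eq_le b0 // andbT; apply: le_trans ci.
under eq_bigr do rewrite scale1r.
by rewrite (bigD1 v) //= lerDl sumr_ge0 // => u /andP[uG _]; exact: b0.
Qed.

Lemma mem_restriction S G : (G \in restriction T S) = (G \in D') && (carrier G \subset S).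
Proof.
rewrite inE; apply: andb_id2l => GD; apply/asboolP/subsetP => [GS i|cS x [w [w0 w1 ->]]].
  apply: contraLR => iS; rewrite inE -leNgt summxE sumr_le0 // => v vG.
  case: (bP GD vG) => _ b1 bv; rewrite mxE mul1r.
  have := GS _ (hull_vertex _ vG); rewrite -bv => /hull_simplexP-/(_ b1)[_ ->] //.
rewrite -bary_point_lincomb //; apply/hull_simplexP; first by rewrite mass_lincomb.
split=> i => [|iS]; rewrite summxE.
  by apply: sumr_ge0 => v vG; rewrite mxE mulr_ge0 ?w0 //; case: (bP GD vG).
apply: big1 => v vG; rewrite mxE (carrierP GD vG) ?mulr0 //.
by apply: contra iS; exact: cS.
Qed.

(** Bounds the dimension of the restriction to a face of the simplex: an
    [f]-triangle records only the face numbers up to this bound. *)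
Lemma restriction_card S G : G \in restriction T S -> (#|G| <= #|S|)%N.
Proof.
rewrite mem_restriction => /andP[GD /subsetP cS].
apply: (independent_card (bary_independent GD)) => v i vG iS.
by apply: carrierP GD vG _; apply: contra iS; exact: cS.
Qed.

End Coordinates.
End Barycentric.

(** * Face counts by half-open intervals *)

Section Counting.
Implicit Types (V : finType) (U : nmodType).

Lemma sum_by_card V U (A : {set {set V}}) s (w : nat -> U) :
  (forall G, G \in A -> (#|G| <= s)%N) ->
  \sum_(G in A) w #|G| = \sum_(i < s.+1) w i *+ #|[set G in A | #|G| == i]|.
Proof.
move=> As; rewrite (partition_big (fun G : {set V} => inord #|G| : 'I_s.+1) xpredT) //.
apply: eq_bigr => i _; rewrite -sumr_const; apply: eq_big => G.
  rewrite inE; apply: andb_id2l => GA.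
  by rewrite -val_eqE /= inordK // ltnS As.
by case/andP=> GA /eqP <-; rewrite inordK // ltnS As.
Qed.

Lemma sum_subsets_by_card V U (w : nat -> U) :
  \sum_(S : {set V}) w #|S| = \sum_(k < #|V|.+1) w k *+ 'C(#|V|, k).
Proof.
transitivity (\sum_(S in [set: {set V}]) w #|S|).
  by apply: eq_bigl => S; rewrite inE.
rewrite (@sum_by_card _ _ _ #|V|) => [|S _]; last exact: max_card.
apply: eq_bigr => k _; rewrite -card_draws; congr (_ *+ #|pred_of_set _|).
by apply/setP => S; rewrite !inE.
Qed.

(** Expand the product over the vertices of [F] in which those of [N] contribute
    [X] and the other ones [X + (1 - X)]. *)
Lemma interval_weight V (N F : {set V}) : N \subset F ->
  \sum_(G : {set V} | (N \subset G) && (G \subset F))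
    'X^#|G| * (1 - 'X) ^+ (#|F| - #|G|) = 'X^#|N| :> {poly int}.
Proof.
move=> NF; pose a v : {poly int} := if v \in F then 'X else 0.
pose c v : {poly int} := if v \in N then 0 else if v \in F then 1 - 'X else 1.
have prodE (A : {set V}) (x : {poly int}) :
    \prod_v (if v \in A then x else 1) = x ^+ #|A|.
  by rewrite -big_mkcond prodr_const.
have -> : 'X^#|N| = \prod_v (a v + c v).
  rewrite -prodE; apply: eq_bigr => v _; rewrite /a /c.
  case: (boolP (v \in N)) => [/(subsetP NF) -> | _]; first by rewrite addr0.
  by case: ifP; rewrite ?add0r // addrC subrK.
rewrite bigA_distr big_mkcond; apply: eq_bigr => G _; case: ifPn => [/andP[NG GF]|].
  rewrite -!prodE -(setIidPr GF) -cardsD -prodE -big_split.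
  apply: eq_bigr => v _; rewrite /a /c !inE.
  case: (boolP (v \in G)) => [vG|vG] /=.
    by rewrite (subsetP GF) //= mulr1.
  have /negPf-> : v \notin N by apply: contra vG; exact: (subsetP NG).
  by rewrite andbF mul1r.
rewrite negb_and => /orP[] /subsetPn[v vN vG]; rewrite (bigD1 v) //=.
  by rewrite (negPf vG) /c vN mul0r.
by rewrite vN /a (negPf vG) mul0r.
Qed.

(** Moebius inversion on the subsets of [V], read off from a product over [V]
    whose factors are [1] on [A] and [1 - 1] outside. *)
Lemma sum_signed_supersets V (A : {set V}) :
  \sum_(S : {set V} | A \subset S) (-1) ^+ (#|V| - #|S|) = (A == setT)%:R :> {poly int}.
Proof.
pose c v : {poly int} := if v \in A then 0 else -1.
transitivity (\prod_v (1 + c v)).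
  rewrite bigA_distr big_mkcond; apply: eq_bigr => S _; case: ifPn => [AS|].
    rewrite -{1}(setCK S) -cardsCs -prodr_const big_mkcond; apply: eq_bigr => v _.
    rewrite inE /c; case: (boolP (v \in S)) => // vS /=.
    by have /negPf-> : v \notin A by apply: contra vS; exact: (subsetP AS).
  move=> /subsetPn[v vA vS]; rewrite (bigD1 v) //= (negPf vS) /c vA mul0r //.
have [AT|AT] := eqVneq A setT.
  by rewrite big1 // => v _; rewrite /c AT inE addr0.
have /subsetPn[v _ vA] : ~~ (setT \subset A) by rewrite subTset.
by rewrite (bigD1 v) //= /c (negPf vA) subrr mul0r.
Qed.

End Counting.

Lemma le_sizeW d n k : le_size n d -> (k <= n)%N -> le_size k d.
Proof. by case: d => //= e ne kn; exact: leq_trans kn ne. Qed.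

Section Reciprocity.
Variables (R : realType) (d : option nat) (f : ftriangle) (n : nat).
Variables (V' : finType) (D' : complex V') (T : triangulation R (simplex n) D').
Hypotheses (hn : le_size n d) (uT : uniform d f T).

Local Notation weight G := ('X^#|G| * (1 - 'X) ^+ (n - #|G|) : {poly int}).

(** The restriction to [S] has the [h]-polynomial [hF f #|S|]; the extra factor
    gives its faces the weights that they have in the whole triangulation. *)
Lemma hF_face (S : {set 'I_n}) :
  (1 - 'X) ^+ (n - #|S|) * hF f #|S| = \sum_(G in restriction T S) weight G.
Proof.
have Sn : (#|S| <= n)%N by rewrite -[X in (_ <= X)%N]card_ord max_card.
have [b bP] := exists_bary_coords T.
rewrite (sum_by_card (s := #|S|) (fun i => 'X^i * (1 - 'X) ^+ (n - i))); last first.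
  by move=> G; exact: (restriction_card bP).
rewrite mulr_sumr; apply: eq_bigr => i _; have iS : (i <= #|S|)%N by rewrite -ltnS.
have <- : f i #|S| = #|[set G in restriction T S | #|G| == i]|.
  by rewrite -(uT.2 i _ iS (le_sizeW hn Sn) S _ erefl) ?inE.
rewrite /fF coef_poly ltn_ord -natz scaler_nat mulrnAr; congr (_ *+ _).
by rewrite mulrCA -exprD addnBA // subnK.
Qed.

(** The [h]-polynomial as a sum over facets, simultaneously with its reverse as
    the weighted count of interior faces. The exponent [a F] is [#|N F|] for a
    half-open decomposition. *)
Lemma uniform_reciprocity : exists a : {set V'} -> nat,
  [/\ forall F, F \in facets D' -> (a F <= n)%N,
      hF f n = \sum_(F in facets D') 'X^(a F)
    & \sum_(k < n.+1) (('X - 1) ^+ (n - k) * hF f k) *+ 'C(n, k)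
        = \sum_(F in facets D') 'X^(n - a F)].
Proof.
have [b bP] := exists_bary_coords T; have fanD := bary_fan bP.
have [N [NF N1 N2]] := half_open_decomposition fanD.
have -> : facets D' = chambers n D'.
  apply/setP => F; rewrite !inE; apply/maxsetP/andP => [[FD Fmax]|[FD /eqP Fn]].
    split=> //; have /eqP/cards1P[F' /setP/(_ F')] := N1 F FD.
    rewrite !inE eqxx => /andP[/andP[F'D F'n] /andP[_ FF']].
    by rewrite -(Fmax F' F'D FF').
  split=> // G GD FG; apply/eqP; rewrite eq_sym eqEcard FG Fn.
  exact: fan_card fanD _ GD.
have cardF F : F \in chambers n D' -> #|F| = n by rewrite inE => /andP[_ /eqP].
have count (w : {set V'} -> {poly int}) (M : {set V'} -> {set V'}) :
    \sum_(G in D') w G *+ #|[set F in chambers n D' | (M F \subset G) && (G \subset F)]|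
    = \sum_(F in chambers n D') \sum_(G : {set V'} | (M F \subset G) && (G \subset F)) w G.
  under eq_bigr do rewrite -sumr_const.
  rewrite (exchange_big_dep (mem (chambers n D'))) /=; last first.
    by move=> G F _; rewrite inE => /andP[].
  apply: eq_bigr => F Fc; apply: eq_bigl => G.
  rewrite inE Fc /=; apply: andb_idl => /andP[_ GF].
  by apply: complexS GF _; move: Fc; rewrite inE => /andP[].
exists (fun F => #|N F|); split.
- by move=> F Fc; rewrite -(cardF F Fc) subset_leq_card // NF.
- have := hF_face setT; rewrite cardsT card_ord subnn expr0 mul1r => ->.
  transitivity (\sum_(G in D') weight G *+ 1).
    apply: eq_bigl => G; rewrite (mem_restriction bP).
    by rewrite subsetT andbT.
  under eq_bigr => G GD do rewrite -(N1 G GD).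
  rewrite count; apply: eq_bigr => F Fc.
  by rewrite -(cardF F Fc) interval_weight // NF.
  (* The sum over [k] is an inclusion-exclusion over the faces of the simplex;
     what remains are the faces whose carrier is the whole simplex. *)
- transitivity (\sum_(G in D') weight G *+ [forall i, 0 < center b G 0 i]).
    pose w k := ('X - 1) ^+ (n - k) * hF f k.
    have := @sum_subsets_by_card 'I_n _ w; rewrite card_ord => <-.
    transitivity (\sum_(S : {set 'I_n}) \sum_(G in restriction T S)
        (-1) ^+ (n - #|S|) * weight G).
      apply: eq_bigr => S _; rewrite /w -opprB (exprNn (1 - 'X)) -mulrA hF_face.
      by rewrite mulr_sumr.
    rewrite (exchange_big_dep (mem D')) /=; last first.
      by move=> S G _; rewrite (mem_restriction bP) => /andP[].
    apply: eq_bigr => G GD; rewrite -mulr_suml.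
    under eq_bigl => S do rewrite (mem_restriction bP) GD /=.
    have := sum_signed_supersets (carrier b G); rewrite card_ord => ->.
    rewrite mulr_natl; congr (_ *+ nat_of_bool _).
    apply/eqP/forallP => [/setP cT i|cT]; first by have := cT i; rewrite !inE.
    by apply/setP => i; rewrite !inE cT.
  under eq_bigr => G GD do rewrite -(N2 G GD).
  rewrite count; apply: eq_bigr => F Fc.
  rewrite -{1}(cardF F Fc) interval_weight ?subsetDl //.
  by rewrite cardsDS ?NF // (cardF F Fc).
Qed.

End Reciprocity.

(** * Umbral evaluation *)

Section Umbral.
Variable A : comNzRingType.
Implicit Types (l h : nat -> A) (P Q : {poly A}).

(** The linear map sending ['X^i] to [l i]. *)
Definition umbral l P : A := \sum_(i < size P) P`_i * l i.

Lemma umbral_wide l P m : (size P <= m)%N -> umbral l P = \sum_(i < m) P`_i * l i.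
Proof.
move=> Pm; rewrite /umbral -!(big_mkord xpredT (fun i => P`_i * l i)).
rewrite [RHS](@big_cat_nat _ _ _ (size P)) //= [X in _ + X]big_nat_cond.
rewrite [X in _ + X]big1 ?addr0 // => i /andP[/andP[Pi _] _].
by rewrite nth_default // mul0r.
Qed.

Lemma umbralD l P Q : umbral l (P + Q) = umbral l P + umbral l Q.
Proof.
rewrite (umbral_wide l (size_polyD P Q)) (umbral_wide l (leq_maxl _ (size Q))).
rewrite (umbral_wide l (leq_maxr (size P) _)) -big_split.
by apply: eq_bigr => i _; rewrite coefD mulrDl.
Qed.

Lemma umbralZ l a P : umbral l (a *: P) = a * umbral l P.
Proof.
rewrite (umbral_wide l (size_scale_leq a P)) mulr_sumr.
by apply: eq_bigr => i _; rewrite coefZ mulrA.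
Qed.

Lemma umbral_sum l (I : Type) (r : seq I) (F : I -> {poly A}) :
  umbral l (\sum_(i <- r) F i) = \sum_(i <- r) umbral l (F i).
Proof.
elim/big_ind2: _ => // [|P a Q b <- <-]; last by rewrite umbralD.
by rewrite /umbral size_poly0 big_ord0.
Qed.

Lemma umbralXn l n : umbral l 'X^n = l n.
Proof.
rewrite (umbral_wide l (leqnn _)) size_polyXn big_ord_recr /= coefXn eqxx mul1r.
by rewrite big1 ?add0r // => i _; rewrite coefXn ltn_eqF ?mul0r.
Qed.

Lemma umbral_comp l h Q P : (forall n, l n = umbral h (Q ^+ n)) ->
  umbral l P = umbral h (P \Po Q).
Proof.
move=> lh; rewrite comp_polyE umbral_sum; apply: eq_bigr => i _.
by rewrite umbralZ lh.
Qed.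

Lemma coef_shiftX (a : A) k i : ((a%:P + 'X) ^+ k)`_i = a ^+ (k - i) *+ 'C(k, i).
Proof.
rewrite exprDn coef_sum; under eq_bigr => j _ do
  rewrite coefMn -rmorphXn coefCM coefXn.
have [ik|ki] := leqP i k.
  rewrite (bigD1 (Ordinal (n := k.+1) (m := i) ik)) //= eqxx mulr1 big1 ?addr0 // => j.
  by rewrite -val_eqE /= eq_sym => /negPf->; rewrite mulr0 mul0rn.
rewrite bin_small // mulr0n big1 // => j _.
by rewrite gtn_eqF ?mulr0 ?mul0rn // (leq_ltn_trans _ ki) // -ltnS.
Qed.

Lemma size_shiftX (a : A) k : (size ((a%:P + 'X) ^+ k) <= k.+1)%N.
Proof.
apply/leq_sizeP => i ki; rewrite coef_shiftX bin_small //.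
Qed.

End Umbral.

(** * The polynomials [p_(n,k)] *)

Section PF.
Variable f : ftriangle.

Lemma size_hF n : (size (hF f n) <= n.+1)%N.
Proof.
apply: (leq_trans (size_sum _ _ _)); apply/bigmax_leqP => i _.
apply: leq_trans (size_scale_leq _ _) _.
apply: leq_trans (size_polyMleq _ _) _; rewrite size_polyXn addSn /=.
apply: (@leq_trans (i + (n - i).+1)); last by rewrite addnS subnKC // -ltnS.
rewrite leq_add2l; apply: leq_trans (size_poly_exp_leq _ _) _.
by rewrite -opprB size_polyN (size_XsubC 1) mul1n.
Qed.

Lemma lF_umbral n : lF f n = umbral (hF f) (((-1)%:P + 'X) ^+ n).
Proof.
rewrite (umbral_wide _ (size_shiftX _ _)); apply: eq_bigr => k _.
rewrite coef_shiftX -mulr_natr -mul_polyC rmorphM; congr (_ * _ * _).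
  by rewrite rmorphXn rmorphN rmorph1.
by rewrite -natz rmorph_nat.
Qed.

(** The coefficients of [(1 + Y)^(n-k) (x + Y)^k] are the inner sums in the
    definition of [pFpoly], so that [pFpoly f n k] is its umbral evaluation at [lF f];
    substituting [Y - 1] for [Y] evaluates at [hF f] instead. *)
Lemma pFpoly_umbral n k : (k <= n)%N ->
  pFpoly f n k = umbral (hF f) ('X^(n - k) * (('X - 1)%:P + 'X) ^+ k).
Proof.
move=> kn; transitivity (umbral (lF f) ((1%:P + 'X) ^+ (n - k) * ('X%:P + 'X) ^+ k)).
  rewrite (@umbral_wide _ _ _ n.+1).
    apply: eq_bigr => r _; rewrite mulrC coefM; congr (_ * _).
    apply: eq_bigr => i _; rewrite !coef_shiftX expr1n.
    rewrite subnBA; last by rewrite -ltnS.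
    by rewrite mulr_natl -mulrnA -natz scaler_nat mulnC.
  apply: leq_trans (size_polyMleq _ _) _; rewrite -subn1 leq_subLR add1n.
  have := leq_add (size_shiftX (1 : {poly int}) (n - k)) (size_shiftX ('X : {poly int}) k).
  by rewrite addnS addSn subnK.
rewrite (umbral_comp _ lF_umbral) rmorphM !rmorphXn !rmorphD /= !comp_polyC comp_polyX.
congr (umbral _ (_ ^+ _ * _ ^+ _)); first by rewrite addrA -polyCD subrr add0r.
by rewrite addrA -polyCD.
Qed.

Lemma pFpoly0 n : pFpoly f n 0 = hF f n.
Proof. by rewrite pFpoly_umbral // subn0 expr0 mulr1 umbralXn. Qed.

Lemma pFpoly_full n :
  pFpoly f n n = \sum_(k < n.+1) (('X - 1) ^+ (n - k) * hF f k) *+ 'C(n, k).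
Proof.
rewrite pFpoly_umbral // subnn expr0 mul1r (umbral_wide _ (size_shiftX _ _)).
by apply: eq_bigr => k _; rewrite coef_shiftX mulrnAl.
Qed.

(** [Y + (x - 1)] times [Y^(n-k) (Y + x - 1)^k], expanded along the first
    factor. *)
Lemma pFpoly_rec n k : (k <= n)%N ->
  pFpoly f n.+1 k.+1 = pFpoly f n.+1 k + ('X - 1) * pFpoly f n k.
Proof.
move=> kn; rewrite !pFpoly_umbral //; last exact: leqW.
rewrite -umbralZ -umbralD subSS subSn // -mul_polyC; congr umbral.
by rewrite !exprS; ring.
Qed.

Lemma size_pFpoly n k : (k <= n)%N -> (size (pFpoly f n k) <= n.+1)%N.
Proof.
elim: k n => [|k IH] n kn; first by rewrite pFpoly0 size_hF.
case: n kn => // n kn; rewrite pFpoly_rec //.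
apply: leq_trans (size_polyD _ _) _; rewrite geq_max (IH _ (leqW kn)) /=.
apply: leq_trans (size_polyMleq _ _) _.
by rewrite (size_XsubC 1) add2n /= ltnS IH.
Qed.

Lemma pF_nat n k j : (k <= n)%N -> pF f n k (Posz j) = (pFpoly f n k)`_j.
Proof.
move=> kn; rewrite /pF /=; case: ifPn => // jn.
by rewrite nth_default // (leq_trans (size_pFpoly kn)) // ltnNge.
Qed.

(** Valid for every integer [j], because the coefficients of [pFpoly f n k] beyond
    [n] vanish by [size_pFpoly] and agree with the truncation in [pF]. *)
Lemma pF_rec n k (j : int) : (k <= n)%N ->
  pF f n.+1 k.+1 j = pF f n.+1 k j + pF f n k (j - 1) - pF f n k j.
Proof.
move=> kn; have kn' := leqW kn; case: j => [[|j]|j].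
- by rewrite !pF_nat // pFpoly_rec // mulrBl mul1r coefD coefB coefXM /= /pF addrA.
- have -> : Posz j.+1 - 1 = Posz j by rewrite intS addrC addKr.
  by rewrite !pF_nat // pFpoly_rec // mulrBl mul1r coefD coefB coefXM addrA.
- have -> : Negz j - 1 = Negz j.+1 by rewrite !NegzE [in RHS]intS opprD addrC.
  by rewrite /pF /= subrr.
Qed.

Lemma sum_pF n k : (k <= n)%N -> \sum_(j < n.+1) pF f n k j%:Z = (pFpoly f n k).[1].
Proof.
move=> kn; rewrite (horner_coef_wide _ (size_pFpoly kn)).
by apply: eq_bigr => j _; rewrite pF_nat // expr1n mulr1.
Qed.

Lemma pFpoly_at1 n k : (k <= n)%N -> (pFpoly f n k).[1] = (hF f n).[1].
Proof.
elim: k n => [|k IH] n kn; first by rewrite pFpoly0.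
case: n kn => // n kn; rewrite pFpoly_rec // hornerD (IH _ (leqW kn)).
by rewrite hornerM hornerD hornerN hornerX hornerC subrr mul0r addr0.
Qed.

End PF.

(** * The boundary of the simplex *)

Lemma dimS_boundary n : dimS (boundary_simplexS n) = n.
Proof.
apply/eqP; rewrite eqn_leq; apply/andP; split.
  apply/bigmax_leqP => F; rewrite inE => /proper_card.
  by rewrite cardsT card_ord ltnS.
have c : #|[set~ ord0 : 'I_n.+1]| = n by rewrite cardsC1 card_ord.
rewrite -{1}c; apply: (@leq_bigmax_cond _ _ (fun F : {set 'I_n.+1} => #|F|)).
by rewrite inE properT; apply/eqP => /setP/(_ ord0); rewrite !inE eqxx.
Qed.

Lemma fnum_boundary n i : (i <= n)%N -> fnum (boundary_simplexS n) i = 'C(n.+1, i).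
Proof.
move=> ni; rewrite -[in RHS](card_ord n.+1) -card_draws; apply: eq_card => F.
rewrite !inE andb_idl // => /eqP Fi; rewrite properT -(inj_eq (can_inj (@setCK _))).
by rewrite setCT -cards_eq0 cardsCs setCK Fi card_ord subn_eq0 -ltnNge ltnS.
Qed.

(** Multiplied by [1 - X], the defining sum becomes the binomial expansion of
    [(1 - X + X)^(n+1)] without its last term [X^(n+1)]. *)
Lemma hpoly_boundary n : hpoly (boundary_simplexS n) = \sum_(i < n.+1) 'X^i.
Proof.
have X1 : 1 - 'X != 0 :> {poly int}.
  by rewrite -opprB oppr_eq0 polyXsubC_eq0.
apply: (mulfI X1); rewrite -{2}opprB mulNr -subrX1 opprB.
have : (1 - 'X + 'X) ^+ n.+1 = 1 :> {poly int} by rewrite subrK expr1n.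
rewrite exprDn big_ord_recr /= subnn expr0 mul1r binn mulr1n => /(canRL (addrK _)) <-.
rewrite /hpoly /fpoly /htrans dimS_boundary mulr_sumr; apply: eq_bigr => i _.
have ni : (i <= n)%N by rewrite -ltnS.
rewrite coef_poly ltn_ord fnum_boundary // -natz scaler_nat mulrnAr; congr (_ *+ _).
by rewrite mulrCA -exprS -subSn // mulrC.
Qed.

Lemma sum_pF_boundary f n j : (j <= n)%N ->
  \sum_(k < n.+1) pF f n k j%:Z = (hFpoly f (boundary_simplexS n))`_j.
Proof.
move=> jn; rewrite /hFpoly dimS_boundary coef_sum; apply: eq_bigr => k _.
have kn : (k <= n)%N by rewrite -ltnS.
rewrite hpoly_boundary coefZ coef_sum (bigD1 k) //= coefXn eqxx big1 ?addr0 ?mul1r.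
  by rewrite pF_nat.
by move=> i; rewrite -val_eqE /= coefXn eq_sym => /negPf->.
Qed.


(** * Symmetry and the main result *)

(** By [uniform_reciprocity] both sides count the facets [F] with [a F = j]. *)
Lemma pF_palindrome_ends (R : realType) d f n (j : int) :
  feasible R d f -> le_size n d -> pF f n 0 j = pF f n n (n%:Z - j).
Proof.
move=> hf hn; rewrite /pF subr_ge0 lerBlDr lerDl andbC; case: ifP => // /andP[jn j0].
case: j j0 jn => // j _ jn; rewrite lez_nat in jn.
have [V' [D' [T uT]]] := hf n hn.
have [a [an hE hE']] := uniform_reciprocity hn uT.
rewrite subzn // pFpoly0 pFpoly_full hE hE' !coef_sum; apply: eq_bigr => F Fc /=.
rewrite !coefXn; congr (nat_of_bool _)%:R.
by apply/eqP/eqP; have := an F Fc; lia.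
Qed.

(** Both sides satisfy the recurrence: under [k -> n - k], [j -> n - j] the terms
    with shifted and unshifted [j] are exchanged, which is compensated by
    reading the recurrence backwards in [k]. *)
Lemma pF_symmetry (R : realType) d f n k (j : int) :
  feasible R d f -> le_size n d -> (k <= n)%N -> pF f n k j = pF f n (n - k) (n%:Z - j).
Proof.
move=> hf; elim: k n j => [|k IH] n j hn kn; first by rewrite subn0 (pF_palindrome_ends _ hf).
case: n hn kn => // n hn kn; have hn' : le_size n d by exact: le_sizeW hn (leqnSn n).
rewrite pF_rec // (IH _ _ hn (leqW kn)) !(IH n _ hn') // subSn // pF_rec ?leq_subr //.
rewrite subSS.
have -> : n%:Z - (j - 1) = n.+1%:Z - j by lia.
have -> : n.+1%:Z - j - 1 = n%:Z - j by lia.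
ring.
Qed.

Theorem proposition4p6 (R : realType) (d : option nat) (f : ftriangle)
    (hf : feasible R d f) (n : nat) (hn : le_size n d) :
  [/\ (* (a) *)
      forall k j : nat, (k <= n)%N -> (j <= n)%N ->
        pF f n k j%:Z = pF f n (n - k)%N (n%:Z - j%:Z),
      (* (b) *)
      forall k j : nat, (1 <= k)%N -> (k <= n)%N -> (j <= n)%N ->
        pF f n k j%:Z = pF f n (k - 1)%N j%:Z
          + pF f (n - 1)%N (k - 1)%N (j%:Z - 1) - pF f (n - 1)%N (k - 1)%N j%:Z,
      (* (c) *)
      (forall j : nat, (j <= n)%N -> pF f n 0 j%:Z = hFnum f j n) /\
      \sum_(j < n.+1) pF f n 0 j%:Z *: 'X^j = hF f n,
      (* (d) *)
      [/\ forall k : nat, (k <= n)%N ->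
            \sum_(j < n.+1) pF f n k j%:Z = (hF f n).[1],
          forall k k' : nat, (k <= n)%N -> (k' <= n)%N ->
            \sum_(j < n.+1) pF f n k j%:Z = \sum_(j < n.+1) pF f n k' j%:Z
        & forall (V' : finType) (D' : complex V')
            (T : triangulation R (simplex n) D'), uniform d f T ->
            forall k : nat, (k <= n)%N ->
            \sum_(j < n.+1) pF f n k j%:Z = #|facets D'|%:Z]
    & (* (e) *)
      forall j : nat, (j <= n)%N ->
        \sum_(k < n.+1) pF f n k j%:Z = (hFpoly f (boundary_simplexS n))`_j].
Proof.
have sum1 k : (k <= n)%N -> \sum_(j < n.+1) pF f n k j%:Z = (hF f n).[1].
  by move=> kn; rewrite sum_pF // pFpoly_at1.
split.
- by move=> k j kn _; exact: pF_symmetry hf hn kn.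
- case=> // k j _ kn _; have [m nm] : exists m, n = m.+1 by exists n.-1; rewrite (ltn_predK kn).
  by rewrite nm in kn *; rewrite !subn1 pF_rec.
- split=> [j _|]; first by rewrite pF_nat // pFpoly0.
  rewrite -(poly_def _ (fun j => pF f n 0 j%:Z)); apply/polyP => j.
  rewrite coef_poly; case: ifPn => [jn|nj].
    by rewrite pF_nat // pFpoly0.
  by rewrite nth_default // (leq_trans (size_hF f n)) // leqNgt.
- split=> // [k k' kn k'n|V' D' T uT k kn]; first by rewrite !sum1.
  have [a [_ hE _]] := uniform_reciprocity hn uT.
  rewrite sum1 // hE horner_sum -sum1_card -natz natr_sum.
  by apply: eq_bigr => F _; rewrite hornerXn expr1n.
- by move=> j; exact: sum_pF_boundary.
Qed.
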